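(* Let $V$ be a smooth scheme over a field, let $\mathcal{G}=\bigoplus_n I_nW^n$ be a Rees algebra over $V$, let $x\in\mathrm{Sing}(\mathcal{G})$, and suppose that locally at $x$, $\mathcal{G}=\mathcal{O}_{V,x}[f_1W^{n_1},\dots,f_sW^{n_s}]$ with all $n_i\ge1$. Let $N>0$ be an integer which is a common multiple of all $n_i$, $i=1,\dots,s$, and let $\mathcal{G}_N=\mathcal{O}_V[I_NW^N]$ be the Rees ring attached to $I_N$. Then: 1. $\mathbb{I}_{\mathcal{G}_N,x}=\langle \mathrm{In}_N(I_N)\rangle$. 2. $\sqrt{\mathbb{I}_{\mathcal{G}_N,x}}=\sqrt{\langle \mathrm{In}_N(I_N)\rangle}=\sqrt{\mathbb{I}_{\mathcal{G},x}}$.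
   Context: A Rees algebra over a smooth scheme $V$ is a graded subalgebra $\mathcal{G}=\bigoplus_{n\ge 0} I_nW^n$ of $\mathcal{O}_V[W]$ ($W$ a dummy variable), where the $I_n$ are sheaves of ideals with $I_0=\mathcal{O}_V$ and $I_sI_t\subset I_{s+t}$, which is locally a finitely generated $\mathcal{O}_V$-algebra. The singular locus is $\mathrm{Sing}(\mathcal{G})=\{x\in V : \nu_x(I_n)\ge n \text{ for all } n\ge 1\}$, with $\nu_x(I_n)$ the order of $I_n$ at $\mathcal{O}_{V,x}$. $\mathcal{G}_N=\mathcal{O}_V[I_NW^N]$ is the subalgebra of $\mathcal{O}_V[W]$ generated by $I_NW^N$, whose component of degree $mN$ is $I_N^m W^{mN}$ and whose components in degrees not divisible by $N$ are zero. Let $\mathfrak{M}_x$ be the maximal ideal of $\mathcal{O}_{V,x}$. For an ideal $J\subset\mathfrak{M}_x^n$, $\mathrm{In}_n(J)$ denotes the image of $J$ in $\mathfrak{M}_x^n/\mathfrak{M}_x^{n+1}$. For a Rees algebra $\mathcal{H}=\bigoplus J_nW^n$ with $x\in\mathrm{Sing}(\mathcal{H})$, $\mathbb{I}_{\mathcal{H},x}$ is the homogeneous ideal of $gr_{\mathfrak{M}_x}(\mathcal{O}_{V,x})$ generated by all $\mathrm{In}_n(J_n)$, $n\ge1$. *)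

(* Defs.v *)
From HB Require Import structures.
From mathcomp Require Import all_boot all_algebra.
From mathcomp Require Import boolp classical_sets topology.

Set Implicit Arguments.
Unset Strict Implicit.
Unset Printing Implicit Defensive.

Import GRing.Theory.
Local Open Scope classical_set_scope.
Local Open Scope quotient_scope.
Local Open Scope ring_scope.

Section Ideals.
Variable R : comPzRingType.
Implicit Types (I J E : set R) (a b : R).

Definition is_ideal I : Prop :=
  [/\ I 0, forall a b, I a -> I b -> I (a + b) & forall c a, I a -> I (c * a)].

Definition ideal_gen E : set R :=
  [set a | forall I, is_ideal I -> E `<=` I -> I a].

Definition ideal_mul I J : set R :=
  ideal_gen [set c | exists a b, [/\ I a, J b & c = a * b]].

Fixpoint ideal_pow I n : set R :=
  if n is m.+1 then ideal_mul I (ideal_pow I m) else setT.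

Definition radical I : set R := [set a | exists n, I (a ^+ n)].

Definition prime_ideal I : Prop :=
  [/\ is_ideal I, ~ I 1 & forall a b, I (a * b) -> I a \/ I b].

Definition invertible a : Prop := exists b, a * b = 1.

Definition nonunits : set R := [set a | ~ invertible a].

Definition is_local : Prop :=
  (1 : R) <> 0 /\ forall a b, nonunits a -> nonunits b -> nonunits (a + b).

(* The order of [J] with respect to the powers of [M], [None] being infinity:
   the powers decrease, so the largest [n] with [J `<=` M ^ n] is the least [n]
   with [~ J `<=` M ^ n.+1]. *)
Definition ideal_order (M J : set R) : option nat :=
  match pselect (exists n, `[< ~ (J `<=` ideal_pow M n.+1) >]) with
  | left ex_n => Some (ex_minn ex_n)
  | right _ => None
  end.

Lemma ideal_gen_ideal E : is_ideal (ideal_gen E).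
Proof.
split=> [I [I0 _ _] _ //|a b Ha Hb I hI sub|c a Ha I hI sub].
  by case: (hI) => _ ID _; apply: ID; [apply: Ha|apply: Hb].
by case: (hI) => _ _ IM; apply: IM; apply: Ha.
Qed.

Lemma sub_ideal_gen E : E `<=` ideal_gen E.
Proof. by move=> a Ea I _; apply. Qed.

Lemma ideal_pow_ideal I n : is_ideal (ideal_pow I n).
Proof. by case: n => [|n]; [split|apply: ideal_gen_ideal]. Qed.

Lemma idealN I a : is_ideal I -> I a -> I (- a).
Proof. by case=> _ _ IM Ia; rewrite -mulN1r; apply: IM. Qed.

Lemma ideal_mulP I J a b : I a -> J b -> ideal_mul I J (a * b).
Proof. by move=> Ia Jb; apply: sub_ideal_gen; exists a, b. Qed.

Lemma ideal_powD I m n a b :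
  ideal_pow I m a -> ideal_pow I n b -> ideal_pow I (m + n) (a * b).
Proof.
elim: m a b => [|m IHm] a b Ia Ib.
  by have [_ _ IM] := ideal_pow_ideal I n; apply: IM.
have [K0 KD KM] := ideal_pow_ideal I (m.+1 + n).
apply: (Ia [set a | ideal_pow I (m.+1 + n) (a * b)]) => [|_ [c [d [Ic Id ->]]]].
  split=> /= [|c d Hc Hd|c d Hd]; first by rewrite mul0r.
    by rewrite mulrDl; apply: KD.
  by rewrite -mulrA; apply: KM.
by rewrite /= -mulrA; apply: ideal_mulP => //; apply: IHm.
Qed.

Lemma ideal_pow_sub I n : ideal_pow I n.+1 `<=` ideal_pow I n.
Proof.
move=> a Ha; apply: Ha => [|_ [c [d [_ Id ->]]]]; first exact: ideal_pow_ideal.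
by have [_ _ KM] := ideal_pow_ideal I n; apply: KM.
Qed.

End Ideals.

Definition order_ge (nu : option nat) (n : nat) : Prop :=
  if nu is Some m then (n <= m)%N else True.

Section Quotient.
Variables (R : comPzRingType) (I : set R) (hI : is_ideal I).

Definition quo_rel : rel R := fun a b => `[< I (a - b) >].

Lemma quo_rel_equiv : equiv_class_of quo_rel.
Proof.
have [I0 ID _] := hI; split=> [a|a b|b a c].
- by apply/asboolP; rewrite subrr.
- by apply/asboolP/asboolP => H; rewrite -opprB; apply: idealN.
- by move=> /asboolP H /asboolP K; apply/asboolP; rewrite -(subrKA b); apply: ID.
Qed.

Canonical quo_equiv := EquivRelPack quo_rel_equiv.

Definition quo := {eq_quot quo_equiv}.
HB.instance Definition _ : EqQuotient R quo_equiv quo := EqQuotient.on quo.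
HB.instance Definition _ := Choice.on quo.

Definition quo_class (a : R) : quo := \pi_quo a.

Lemma quo_classP a b : quo_class a = quo_class b <-> I (a - b).
Proof. by split=> [/eqmodP/asboolP|/asboolP H]; last apply/eqmodP. Qed.

Lemma quo_surj u : exists a, u = quo_class a.
Proof. by exists (repr u); rewrite /quo_class reprK. Qed.

Definition quo_add (u v : quo) : quo := quo_class (repr u + repr v).
Definition quo_opp (u : quo) : quo := quo_class (- repr u).
Definition quo_mul (u v : quo) : quo := quo_class (repr u * repr v).

Lemma repr_quo a : I (repr (quo_class a) - a).
Proof. by apply/quo_classP; rewrite /quo_class reprK. Qed.

Lemma quo_classD a b : quo_add (quo_class a) (quo_class b) = quo_class (a + b).
Proof.
have [_ ID _] := hI; apply/quo_classP; rewrite opprD addrACA.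
by apply: ID; apply: repr_quo.
Qed.

Lemma quo_classN a : quo_opp (quo_class a) = quo_class (- a).
Proof. by apply/quo_classP; rewrite -opprD; apply: idealN => //; apply: repr_quo. Qed.

Lemma quo_classM a b : quo_mul (quo_class a) (quo_class b) = quo_class (a * b).
Proof.
have [_ ID IM] := hI; apply/quo_classP.
set a' := repr _; set b' := repr _.
have -> : a' * b' - a * b = a' * (b' - b) + b * (a' - a).
  by rewrite !mulrBr [b * a']mulrC [b * a]mulrC addrA subrK.
by apply: ID; apply: IM; apply: repr_quo.
Qed.

Lemma quo_addA : associative quo_add.
Proof.
by move=> u v w; have [[a ->] [b ->] [c ->]] := And3 (quo_surj u) (quo_surj v) (quo_surj w);
  rewrite !quo_classD addrA.
Qed.
Lemma quo_addC : commutative quo_add.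
Proof. by move=> u v; rewrite /quo_add addrC. Qed.
Lemma quo_add0 : left_id (quo_class 0) quo_add.
Proof. by move=> u; have [a ->] := quo_surj u; rewrite quo_classD add0r. Qed.
Lemma quo_addN : left_inverse (quo_class 0) quo_opp quo_add.
Proof.
by move=> u; have [a ->] := quo_surj u; rewrite quo_classN quo_classD addNr.
Qed.
HB.instance Definition _ :=
  GRing.isZmodule.Build quo quo_addA quo_addC quo_add0 quo_addN.

Lemma quo_mulA : associative quo_mul.
Proof.
by move=> u v w; have [[a ->] [b ->] [c ->]] := And3 (quo_surj u) (quo_surj v) (quo_surj w);
  rewrite !quo_classM mulrA.
Qed.
Lemma quo_mulC : commutative quo_mul.
Proof. by move=> u v; rewrite /quo_mul mulrC. Qed.
Lemma quo_mul1 : left_id (quo_class 1) quo_mul.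
Proof. by move=> u; have [a ->] := quo_surj u; rewrite quo_classM mul1r. Qed.
Lemma quo_mulDl : left_distributive quo_mul quo_add.
Proof.
by move=> u v w; have [[a ->] [b ->] [c ->]] := And3 (quo_surj u) (quo_surj v) (quo_surj w);
  rewrite quo_classD !quo_classM quo_classD mulrDl.
Qed.
HB.instance Definition _ :=
  GRing.Zmodule_isComPzRing.Build quo quo_mulA quo_mulC quo_mul1 quo_mulDl.

Lemma quo_class_zmod_morphism : zmod_morphism quo_class.
Proof.
by move=> a b; rewrite -quo_classD -quo_classN.
Qed.
Lemma quo_class_monoid_morphism : monoid_morphism quo_class.
Proof. by split=> [//|a b]; rewrite -quo_classM. Qed.
HB.instance Definition _ :=
  GRing.isZmodMorphism.Build R quo quo_class quo_class_zmod_morphism.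
HB.instance Definition _ :=
  GRing.isMonoidMorphism.Build R quo quo_class quo_class_monoid_morphism.

End Quotient.

Section Graded.
Variables (R : comNzRingType) (M : set R).

(* The subring [\bigoplus_n M^n W^n] of [R[W]]. *)
Definition blowup_pred : {pred {poly R}} :=
  fun p => `[< forall n, ideal_pow M n p`_n >].

Lemma blowup_subring : subring_closed blowup_pred.
Proof.
split=> [|p q /asboolP Hp /asboolP Hq|p q /asboolP Hp /asboolP Hq];
  apply/asboolP => n.
- rewrite coef1; case: n => [|n] //=.
  by have [K0 _ _] := ideal_pow_ideal M n.+1.
- have [_ KD _] := ideal_pow_ideal M n; rewrite coefB; apply: KD => //.
  by apply: idealN => //; apply: ideal_pow_ideal.
- rewrite coefM; have [K0 KD _] := ideal_pow_ideal M n.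
  apply: (big_ind (ideal_pow M n)) => // i _.
  by have := ideal_powD (Hp i) (Hq (n - i)%N); rewrite subnKC // -ltnS.
Qed.

Definition blowup_ring := {p : {poly R} | blowup_pred p}.
HB.instance Definition _ := SubChoice.on blowup_ring.
HB.instance Definition _ :=
  GRing.isSubringClosed.Build {poly R} blowup_pred blowup_subring.
HB.instance Definition _ :=
  [SubChoice_isSubComNzRing of blowup_ring by <:].

Definition gr_rel : set blowup_ring :=
  [set p : blowup_ring | forall n, ideal_pow M n.+1 (val p : {poly R})`_n].

Lemma gr_rel_ideal : is_ideal gr_rel.
Proof.
split=> [n|p q Hp Hq n|p q Hq n].
- by have [K0 _ _] := ideal_pow_ideal M n.+1; rewrite raddf0 coef0.
- by have [_ KD _] := ideal_pow_ideal M n.+1; rewrite raddfD coefD; apply: KD.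
- have [K0 KD _] := ideal_pow_ideal M n.+1; rewrite rmorphM coefM.
  apply: (big_ind (ideal_pow M n.+1)) => // i _.
  have Hp : ideal_pow M i (val p : {poly R})`_i by case: p => p /= /asboolP.
  by have := ideal_powD Hp (Hq (n - i)%N); rewrite addnS subnKC // -ltnS.
Qed.

(* [\bigoplus_n M^n / M^n.+1], as the quotient of [\bigoplus_n M^n W^n] by
   [\bigoplus_n M^n.+1 W^n]. *)
Definition gr : comPzRingType := quo gr_rel_ideal.

(* The classes of [a W^n] for [a] in [J]; requiring [a W^n] to lie in the
   subring is no restriction when [J `<=` ideal_pow M n]. *)
Definition In (n : nat) (J : set R) : set gr :=
  [set u | exists2 p : blowup_ring,
     (exists2 a, J a & val p = a%:P * 'X^n :> {poly R}) & u = quo_class gr_rel_ideal p].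

End Graded.

Section Subalgebra.
Variable R : comNzRingType.

Definition is_subalgebra (S : set {poly R}) : Prop :=
  [/\ forall c, S c%:P, forall p q, S p -> S q -> S (p + q)
    & forall p q, S p -> S q -> S (p * q)].

Definition subalgebra_gen (E : set {poly R}) : set {poly R} :=
  [set p | forall S, is_subalgebra S -> E `<=` S -> S p].

(* [R[f_1 W^{n_1}, ..., f_s W^{n_s}]] *)
Definition monomial_subalgebra s (f : 'I_s -> R) (n : 'I_s -> nat) :
    set {poly R} :=
  subalgebra_gen [set p | exists i, p = (f i)%:P * 'X^(n i)].

End Subalgebra.

Record opens (X : topologicalType) :=
  Opens { open_set :> set X; open_setP : open open_set }.

Definition opens_mem (X : topologicalType) (U : opens X) (y : X) : Prop :=
  open_set U y.
Coercion opens_mem : opens >-> Funclass.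

Definition opensI (X : topologicalType) (U V : opens X) : opens X :=
  Opens (openI (open_setP U) (open_setP V)).
Definition opensT (X : topologicalType) : opens X := Opens (@openT X).

Record ringed_space := RingedSpace {
  space :> topologicalType;
  sec : opens space -> comPzRingType;
  res : forall U V : opens space, V `<=` U -> {rmorphism sec U -> sec V};
  res_id : forall (U : opens space) (h : U `<=` U) s, res h s = s;
  res_comp : forall (U V W : opens space) (h : V `<=` U) (h' : W `<=` V)
      (h'' : W `<=` U) s, res h' (res h s) = res h'' s;
  sheaf_axiom : forall (U : opens space) (I : Type) (V : I -> opens space)
      (sub : forall i, V i `<=` U),
    (forall y, U y -> exists i, V i y) ->
    forall s : forall i, sec (V i),
    (forall i j (W : opens space) (hi : W `<=` V i) (hj : W `<=` V j),
       res hi (s i) = res hj (s j)) ->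
    exists! t : sec U, forall i, res (sub i) t = s i }.

Arguments res {r U V} _.

Section Stalk.
Variables (X : ringed_space) (x : X).

Record pregerm := Pregerm {
  pg_open : opens X;
  pg_mem : pg_open x;
  pg_sec : sec pg_open }.

HB.instance Definition _ := gen_eqMixin pregerm.
HB.instance Definition _ := gen_choiceMixin pregerm.

Definition same_germ (a b : pregerm) : Prop :=
  exists (W : opens X) (ha : W `<=` pg_open a) (hb : W `<=` pg_open b),
    W x /\ res ha (pg_sec a) = res hb (pg_sec b).

Definition germ_rel : rel pregerm := fun a b => `[< same_germ a b >].

Lemma germ_rel_equiv : equiv_class_of germ_rel.
Proof.
split=> [a|a b|b a c].
- by apply/asboolP; exists (pg_open a), (fun _ => id), (fun _ => id); split=> //; apply: pg_mem.
- by apply/asboolP/asboolP => -[W [ha [hb [Wx E]]]]; exists W, hb, ha.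
- move=> /asboolP [W [ha [hb [Wx E]]]] /asboolP [Z [hb' [hc [Zx F]]]].
  have sW : opensI W Z `<=` W by move=> y [].
  have sZ : opensI W Z `<=` Z by move=> y [].
  apply/asboolP; exists (opensI W Z), (subset_trans sW ha), (subset_trans sZ hc).
  split=> //; rewrite -(res_comp ha sW) E -(res_comp hc sZ) -F.
  by rewrite (res_comp hb sW (subset_trans sW hb)) (res_comp hb' sZ (subset_trans sW hb)).
Qed.

Canonical germ_equiv := EquivRelPack germ_rel_equiv.

Definition stalk := {eq_quot germ_equiv}.
HB.instance Definition _ : EqQuotient pregerm germ_equiv stalk := EqQuotient.on stalk.
HB.instance Definition _ := Choice.on stalk.

Definition germ (U : opens X) (Ux : U x) (s : sec U) : stalk :=
  \pi_stalk (Pregerm Ux s).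

Lemma germP (U V : opens X) (Ux : U x) (Vx : V x) s t :
  germ Ux s = germ Vx t <->
  exists (W : opens X) (hU : W `<=` U) (hV : W `<=` V),
    W x /\ res hU s = res hV t.
Proof. by split=> [/eqmodP/asboolP|H] //; apply/eqmodP/asboolP. Qed.

Lemma germ_surj g : exists (U : opens X) (Ux : U x) s, g = germ Ux s.
Proof.
exists (pg_open (repr g)), (pg_mem (repr g)), (pg_sec (repr g)).
by rewrite /germ; case: (repr g) (reprK g).
Qed.

Lemma germ_res (U V : opens X) (Ux : U x) (Vx : V x) (h : V `<=` U) s :
  germ Vx (res h s) = germ Ux s.
Proof.
by apply/germP; exists V, (fun _ => id), h; split=> //; rewrite res_id.
Qed.

Lemma germ_surj2 g h : exists (U : opens X) (Ux : U x) s t,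
  g = germ Ux s /\ h = germ Ux t.
Proof.
have [U [Ux [s ->]]] := germ_surj g; have [V [Vx [t ->]]] := germ_surj h.
have sU : opensI U V `<=` U by move=> y [].
have sV : opensI U V `<=` V by move=> y [].
have UVx : opensI U V x by split.
by exists (opensI U V), UVx, (res sU s), (res sV t); rewrite !germ_res.
Qed.

Lemma germ_surj3 g h k : exists (U : opens X) (Ux : U x) s t u,
  [/\ g = germ Ux s, h = germ Ux t & k = germ Ux u].
Proof.
have [U [Ux [s [t [-> ->]]]]] := germ_surj2 g h.
have [V [Vx [u ->]]] := germ_surj k.
have sU : opensI U V `<=` U by move=> y [].
have sV : opensI U V `<=` V by move=> y [].
have UVx : opensI U V x by split.
by exists (opensI U V), UVx, (res sU s), (res sU t), (res sV u); rewrite !germ_res.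
Qed.

Lemma subIl (U V : opens X) : opensI U V `<=` U. Proof. by move=> y []. Qed.
Lemma subIr (U V : opens X) : opensI U V `<=` V. Proof. by move=> y []. Qed.

Definition germ_op2 (op : forall R : comPzRingType, R -> R -> R)
    (g h : stalk) : stalk :=
  let a := repr g in let b := repr h in
  germ (conj (pg_mem a) (pg_mem b) : opensI (pg_open a) (pg_open b) x)
    (op _ (res (@subIl _ _) (pg_sec a)) (res (@subIr _ _) (pg_sec b))).

Lemma germ_repr (U : opens X) (Ux : U x) s :
  germ (pg_mem (repr (germ Ux s))) (pg_sec (repr (germ Ux s))) = germ Ux s.
Proof. by rewrite {3}/germ -[RHS]reprK /germ; case: (repr _). Qed.

Lemma germ_op2E (op : forall R : comPzRingType, R -> R -> R) :
  (forall (R S : comPzRingType) (f : {rmorphism R -> S}), {morph f : a b / op R a b >-> op S a b}) ->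
  forall (U : opens X) (Ux : U x) s t,
    germ_op2 op (germ Ux s) (germ Ux t) = germ Ux (op _ s t).
Proof.
move=> opM U Ux s t; rewrite /germ_op2.
have /germP := germ_repr Ux s; have /germP := germ_repr Ux t.
set a := repr (germ Ux s); set b := repr (germ Ux t).
move=> [V [hb [hU [Vx E]]]] [W [ha [hU' [Wx F]]]]; apply/germP.
have hab : opensI W V `<=` opensI (pg_open a) (pg_open b).
  by move=> y [Wy Vy]; split; [exact: (ha _ Wy)|exact: (hb _ Vy)].
have hWU : opensI W V `<=` U by move=> y [Wy _]; exact: (hU' _ Wy).
exists (opensI W V), hab, hWU; split=> //; rewrite !opM; congr (op _ _ _).
  rewrite (res_comp _ hab (subset_trans (@subIl W V) ha)) -(res_comp ha (@subIl W V)).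
  by rewrite F (res_comp _ _ hWU).
rewrite (res_comp _ hab (subset_trans (@subIr W V) hb)) -(res_comp hb (@subIr W V)).
by rewrite E (res_comp _ _ hWU).
Qed.

Definition stalk_add := germ_op2 (fun R a b => a + b).
Definition stalk_mul := germ_op2 (fun R a b => a * b).
Definition stalk_opp (g : stalk) : stalk :=
  germ (pg_mem (repr g)) (- pg_sec (repr g)).
Definition stalk0 : stalk := @germ (opensT X) I 0.
Definition stalk1 : stalk := @germ (opensT X) I 1.

Lemma germD_ (U : opens X) (Ux : U x) s t :
  stalk_add (germ Ux s) (germ Ux t) = germ Ux (s + t).
Proof. by apply: germ_op2E => R S f a b; rewrite rmorphD. Qed.
Lemma germM_ (U : opens X) (Ux : U x) s t :
  stalk_mul (germ Ux s) (germ Ux t) = germ Ux (s * t).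
Proof. by apply: germ_op2E => R S f a b; rewrite rmorphM. Qed.
Lemma germN_ (U : opens X) (Ux : U x) s :
  stalk_opp (germ Ux s) = germ Ux (- s).
Proof.
rewrite /stalk_opp; have /germP [W [h [hU [Wx E]]]] := germ_repr Ux s.
by apply/germP; exists W, h, hU; split=> //; rewrite !rmorphN E.
Qed.
Lemma germ0_ (U : opens X) (Ux : U x) : germ Ux 0 = stalk0.
Proof. by apply/germP; exists U, (fun _ => id), (fun y _ => I); rewrite !rmorph0. Qed.
Lemma germ1_ (U : opens X) (Ux : U x) : germ Ux 1 = stalk1.
Proof. by apply/germP; exists U, (fun _ => id), (fun y _ => I); rewrite !rmorph1. Qed.

Lemma stalk_addA : associative stalk_add.
Proof.
by move=> g h k; have [U [Ux [s [t [u [-> -> ->]]]]]] := germ_surj3 g h k;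
  rewrite !germD_ addrA.
Qed.
Lemma stalk_addC : commutative stalk_add.
Proof.
by move=> g h; have [U [Ux [s [t [-> ->]]]]] := germ_surj2 g h;
  rewrite !germD_ addrC.
Qed.
Lemma stalk_add0 : left_id stalk0 stalk_add.
Proof.
by move=> g; have [U [Ux [s ->]]] := germ_surj g; rewrite -(germ0_ Ux) germD_ add0r.
Qed.
Lemma stalk_addN : left_inverse stalk0 stalk_opp stalk_add.
Proof.
by move=> g; have [U [Ux [s ->]]] := germ_surj g;
  rewrite germN_ germD_ addNr germ0_.
Qed.
HB.instance Definition _ :=
  GRing.isZmodule.Build stalk stalk_addA stalk_addC stalk_add0 stalk_addN.

Lemma stalk_mulA : associative stalk_mul.
Proof.
by move=> g h k; have [U [Ux [s [t [u [-> -> ->]]]]]] := germ_surj3 g h k;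
  rewrite !germM_ mulrA.
Qed.
Lemma stalk_mulC : commutative stalk_mul.
Proof.
by move=> g h; have [U [Ux [s [t [-> ->]]]]] := germ_surj2 g h;
  rewrite !germM_ mulrC.
Qed.
Lemma stalk_mul1 : left_id stalk1 stalk_mul.
Proof.
by move=> g; have [U [Ux [s ->]]] := germ_surj g; rewrite -(germ1_ Ux) germM_ mul1r.
Qed.
Lemma stalk_mulDl : left_distributive stalk_mul stalk_add.
Proof.
by move=> g h k; have [U [Ux [s [t [u [-> -> ->]]]]]] := germ_surj3 g h k;
  rewrite germD_ !germM_ germD_ mulrDl.
Qed.
HB.instance Definition _ :=
  GRing.Zmodule_isComPzRing.Build stalk stalk_mulA stalk_mulC stalk_mul1 stalk_mulDl.

Section GermMorphism.
Variables (U : opens X) (Ux : U x).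
Lemma germ_zmod_morphism : zmod_morphism (germ Ux).
Proof. by move=> s t; rewrite -germD_ -germN_. Qed.
Lemma germ_monoid_morphism : monoid_morphism (germ Ux).
Proof. by split=> [|s t]; [rewrite germ1_|rewrite -germM_]. Qed.
HB.instance Definition _ :=
  GRing.isZmodMorphism.Build (sec U) stalk (germ Ux) germ_zmod_morphism.
HB.instance Definition _ :=
  GRing.isMonoidMorphism.Build (sec U) stalk (germ Ux) germ_monoid_morphism.
End GermMorphism.

End Stalk.

Definition is_localization_at (A B : comPzRingType) (f : A)
    (g : {rmorphism A -> B}) : Prop :=
  [/\ invertible (g f), forall b, exists a n, b * g f ^+ n = g a
    & forall a, g a = 0 -> exists n, f ^+ n * a = 0].

(* An isomorphism of [(U, O_U)] with [Spec A], where [phi] is the underlying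
   homeomorphism and [alpha] the map on global sections. The structure sheaf of
   [Spec A] is the sheaf of [A]-algebras with sections [A_f] over [D(f)], so the
   isomorphism of sheaves amounts to the last field. *)
Record affine_chart (X : ringed_space) (U : opens X) (A : comPzRingType)
    (phi : X -> set A) (alpha : {rmorphism A -> sec U}) : Prop := {
  chart_prime : forall y, U y -> prime_ideal (phi y);
  chart_inj : forall y z, U y -> U z -> phi y = phi z -> y = z;
  chart_surj : forall P, prime_ideal P -> exists2 y, U y & phi y = P;
  chart_open : forall W : set X, W `<=` U ->
    (open W <-> exists E : set A, W = [set y | U y /\ ~ (E `<=` phi y)]);
  chart_sec : forall (f : A) (W : opens X) (h : W `<=` U),
    (W : set X) = [set y | U y /\ ~ phi y f] ->
    is_localization_at f (res h \o alpha) }.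

Definition is_affine (X : ringed_space) (U : opens X) : Prop :=
  exists (A : comPzRingType) (phi : X -> set A) (alpha : {rmorphism A -> sec U}),
    affine_chart phi alpha.

Record scheme := Scheme {
  scheme_space :> ringed_space;
  scheme_local : forall x : scheme_space, is_local (stalk x);
  scheme_affine : forall x : scheme_space,
    exists2 U : opens scheme_space, U x & is_affine U }.

Section LocalRing.
Variables (V : scheme) (x : V).

Lemma stalk_oner_neq0 : (1 : stalk x) != 0.
Proof. by apply/eqP; have [] := scheme_local x. Qed.
HB.instance Definition _ :=
  GRing.PzSemiRing_isNonZero.Build (@stalk (scheme_space V) x) stalk_oner_neq0.

Definition max_ideal : set (stalk x) := @nonunits (stalk x).

End LocalRing.

Arguments max_ideal {V} x _.

Definition finite_type (k A : comPzRingType) (iota : {rmorphism k -> A}) : Prop :=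
  exists r (e : 'I_r -> A), forall S : set A,
    (forall c, S (iota c)) -> (forall i, S (e i)) ->
    (forall a b, S a -> S b -> S (a + b)) ->
    (forall a b, S a -> S b -> S (a * b)) -> S = setT.

(* Infinitesimal lifting along surjections with kernel of square zero. *)
Definition formally_smooth (k A : comPzRingType) (iota : {rmorphism k -> A}) : Prop :=
  forall (B C : comPzRingType) (p : {rmorphism B -> C})
    (beta : {rmorphism k -> B}) (u : {rmorphism A -> C}),
  (forall c, exists b, p b = c) ->
  (forall b b', p b = 0 -> p b' = 0 -> b * b' = 0) ->
  (forall c, u (iota c) = p (beta c)) ->
  exists2 v : {rmorphism A -> B},
    forall a, p (v a) = u a & forall c, v (iota c) = beta c.

(* A structure morphism [V -> Spec k] is a ring morphism from [k] to the global
   sections. It is smooth if locally of finite presentation, that is, over a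
   field, locally of finite type, and formally smooth. *)
Definition smooth_over (k : fieldType) (V : scheme)
    (iota : {rmorphism k -> sec (opensT V)}) : Prop :=
  forall x : V, exists U : opens V,
    [/\ U x, is_affine U,
        finite_type (res (fun y (_ : U y) => I : opensT V y) \o iota)
      & formally_smooth (res (fun y (_ : U y) => I : opensT V y) \o iota)].

Record ideal_sheaf (X : ringed_space) := IdealSheaf {
  isec :> forall U : opens X, set (sec U);
  isec_ideal : forall U, is_ideal (@isec U);
  isec_res : forall (U V : opens X) (h : V `<=` U) s,
    @isec U s -> @isec V (res h s);
  isec_local : forall (U : opens X) (s : sec U),
    (forall y, U y -> exists (V : opens X) (h : V `<=` U),
       V y /\ @isec V (res h s)) -> @isec U s }.

Arguments isec {X} i U _.

Definition stalk_ideal (X : ringed_space) (I : ideal_sheaf X) (x : X) :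
    set (stalk x) :=
  [set g | exists (U : opens X) (Ux : U x) s, I U s /\ g = germ Ux s].

Arguments stalk_ideal {X} I x _.

Section IdealSheafOps.
Variable X : ringed_space.

Lemma zero_sheaf_local (U : opens X) (s : sec U) :
  (forall y, U y -> exists (V : opens X) (h : V `<=` U),
     V y /\ [set 0] (res h s)) -> [set 0] s.
Proof.
move=> H.
pose K := {V : opens X | exists h : V `<=` U, res h s = 0}.
have subK (i : K) : sval i `<=` U by case: i => V [].
have cov y : U y -> exists i : K, sval i y.
  by move=> /H [V [h [Vy E]]]; exists (exist _ V (ex_intro _ h E)).
have [] := sheaf_axiom subK cov (s := fun i => 0).
  by move=> *; rewrite !rmorph0.
move=> t [_ uniq_t]; rewrite /= -(uniq_t 0) => [|i]; last by rewrite rmorph0.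
symmetry; apply: uniq_t => -[V [h E]] /=.
by rewrite -[RHS]E; congr (res _ s); apply: Prop_irrelevance.
Qed.

Definition zero_sheaf : ideal_sheaf X.
Proof.
apply: (@IdealSheaf X (fun U => [set 0])) => [U|U V h s ->|].
- by split=> [//|a b -> ->|c a ->]; rewrite ?addr0 ?mulr0.
- exact: rmorph0.
- exact: zero_sheaf_local.
Defined.

Lemma ideal_pow_res (I : ideal_sheaf X) m (U V : opens X) (h : V `<=` U) s :
  ideal_pow (I U) m s -> ideal_pow (I V) m (res h s).
Proof.
elim: m s => [//|m IHm] s Hs.
have [K0 KD KM] := ideal_pow_ideal (I V) m.+1.
apply: (Hs [set s | ideal_pow (I V) m.+1 (res h s)]) => [|_ [a [b [Ia Jb ->]]]].
  split=> [|a b Ha Hb|c a Ha] /=; rewrite ?rmorph0 ?rmorphD ?rmorphM //.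
    exact: KD.
  exact: KM.
by rewrite /= rmorphM; apply: ideal_mulP; [apply: isec_res|apply: IHm].
Qed.

(* The sheaf associated with the presheaf [U |-> I(U)^m]. *)
Definition pow_sec (I : ideal_sheaf X) (m : nat) (U : opens X) : set (sec U) :=
  [set s | forall y, U y -> exists (V : opens X) (h : V `<=` U),
     V y /\ ideal_pow (I V) m (res h s)].

Definition pow_sheaf (I : ideal_sheaf X) (m : nat) : ideal_sheaf X.
Proof.
apply: (@IdealSheaf X (pow_sec I m)) => [U|U V h s Hs y Vy|U s H y Uy].
- split=> [y Uy|a b Ha Hb y Uy|c a Ha y Uy].
  + exists U, (fun _ => id); split=> //; rewrite rmorph0.
    by have [] := ideal_pow_ideal (I U) m.
  + have [V [hV [Vy aV]]] := Ha y Uy; have [W [hW [Wy bW]]] := Hb y Uy.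
    pose sV : opensI V W `<=` V := @subIl X V W.
    pose sW : opensI V W `<=` W := @subIr X V W.
    exists (opensI V W), (subset_trans sV hV); split=> //.
    have [_ KD _] := ideal_pow_ideal (I (opensI V W)) m.
    rewrite rmorphD; apply: KD.
      by rewrite -(res_comp hV sV); apply: ideal_pow_res.
    by rewrite -(res_comp hW sW); apply: ideal_pow_res.
  + have [V [hV [Vy aV]]] := Ha y Uy; exists V, hV; split=> //.
    by have [_ _ KM] := ideal_pow_ideal (I V) m; rewrite rmorphM; apply: KM.
- have [W [hW [Wy sW]]] := Hs y (h _ Vy).
  pose sV : opensI V W `<=` V := @subIl X V W.
  pose sW' : opensI V W `<=` W := @subIr X V W.
  exists (opensI V W), sV; split=> //.
  rewrite (res_comp h sV (subset_trans sV h)) -(res_comp hW sW').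
  exact: ideal_pow_res.
- have [V [h [Vy Hs]]] := H y Uy; have [W [h' [Wy sW]]] := Hs y Vy.
  exists W, (subset_trans h' h); split=> //.
  by rewrite -(res_comp h h').
Defined.

End IdealSheafOps.

Section Rees.
Variable V : scheme.
Implicit Types (G : nat -> ideal_sheaf V) (x : V).

(* The stalk at [x] of [\bigoplus_n I_n W^n], inside [O_{V,x}[W]]. *)
Definition rees_stalk G x : set {poly (stalk x)} :=
  [set p | forall n, stalk_ideal (G n) x p`_n].
Arguments rees_stalk G x _ : clear implicits.

(* [G n] is [I_n]. Equality of subsheaves of [O_U[W]] is tested on stalks; local
   finite generation makes every [I_n] coherent. *)
Record rees_algebra G : Prop := {
  rees_0 : forall U, G 0%N U = setT;
  rees_mul : forall m n (U : opens V) (a b : sec U),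
    G m U a -> G n U b -> G (m + n)%N U (a * b);
  rees_fg : forall x, exists (U : opens V) r (f : 'I_r -> sec U) (n : 'I_r -> nat),
    U x /\ forall y (Uy : U y),
      rees_stalk G y = monomial_subalgebra (fun i => germ Uy (f i)) n }.

Definition order_at (I : ideal_sheaf V) x : option nat :=
  ideal_order (max_ideal x) (stalk_ideal I x).

Definition Sing G : set V :=
  [set x | forall n, (0 < n)%N -> order_ge (order_at (G n) x) n].

(* [O_V[I_N W^N]] for [N > 0]. *)
Definition rees_attached G (N : nat) : nat -> ideal_sheaf V :=
  fun n => if (N %| n)%N then pow_sheaf (G N) (n %/ N) else zero_sheaf V.

Definition initial_ideal G x : set (gr (max_ideal x)) :=
  ideal_gen [set u | exists2 n, (0 < n)%N & In n (stalk_ideal (G n) x) u].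

End Rees.

Arguments rees_stalk {V} G x _.
Arguments initial_ideal {V} G x _.

(* Main.v *)
Require Import Defs.
From HB Require Import structures.
From mathcomp Require Import all_boot all_algebra.
From mathcomp Require Import boolp classical_sets topology.

Local Open Scope classical_set_scope.
Local Open Scope ring_scope.

(** For an ideal [K] of [gr M], the elements [a] of [M ^ n] whose class [a W^n]
    lies in [K] form an ideal of [R], compatibly with products.  The first claim
    then only uses that [I_N] divides [I_N ^ m] for [m > 0].  For the
    second one, the polynomials whose positive-degree terms have their classes
    in [K] := the radical of [<In_N (I_N)>] form a subalgebra; it contains every
    generator [f_i W^{n_i}], because the power of exponent [N / n_i] of that
    generator has degree [N], hence its coefficient is in [I_N]. *)

Set Implicit Arguments.
Unset Strict Implicit.
Unset Printing Implicit Defensive.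

Import GRing.Theory.

Section IdealFacts.
Variable R : comPzRingType.
Implicit Types I J E : set R.

Lemma ideal_gen_sub E I : is_ideal I -> E `<=` I -> ideal_gen E `<=` I.
Proof. by move=> hI sEI a; apply. Qed.

Lemma ideal_gen_mono E E' : E `<=` E' -> ideal_gen E `<=` ideal_gen E'.
Proof.
move=> sEE'; apply: ideal_gen_sub; first exact: ideal_gen_ideal.
by move=> a /sEE'; apply: sub_ideal_gen.
Qed.

Lemma ideal_sum I (T : Type) (r : seq T) (P : pred T) (F : T -> R) :
  is_ideal I -> (forall i, P i -> I (F i)) -> I (\sum_(i <- r | P i) F i).
Proof. by move=> [I0 ID _] IF; apply: big_ind. Qed.

Lemma radical_ideal I : is_ideal I -> is_ideal (radical I).
Proof.
move=> hI; have [I0 ID IM] := hI; split=> [|a b [m Im] [n In]|c a [n In]].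
- by exists 1%N; rewrite expr1.
- exists (m + n)%N; rewrite exprDn; apply: ideal_sum => // i _.
  rewrite -mulr_natl; apply: (IM).
  have [le_ni|lt_in] := leqP n i.
    by rewrite -(subnK le_ni) exprD mulrA; apply: IM.
  have le_m : (m <= m + n - i)%N by rewrite -addnBA 1?leq_addr // ltnW.
  by rewrite -(subnKC le_m) exprD -mulrA mulrC; apply: IM.
- by exists n; rewrite exprMn; apply: IM.
Qed.

Lemma radical_mono I J : I `<=` J -> radical I `<=` radical J.
Proof. by move=> sIJ a [n In]; exists n; apply: sIJ. Qed.

Lemma radical_idem I : radical (radical I) `<=` radical I.
Proof. by move=> a [m [n In]]; exists (m * n)%N; rewrite exprM. Qed.

(** For positive [n], if [J] were not inside [M ^ n], then [n.-1] would be a candidate for the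
    minimum defining the order, which would then be below [n]. *)
Lemma ideal_order_ge M J n :
  order_ge (ideal_order M J) n -> J `<=` ideal_pow M n.
Proof.
case: n => // n; rewrite /ideal_order; case: pselect => [ex_n|noex] /=.
  case: ex_minnP => m _ min_m lt_nm.
  apply: contrapT => nJ; have := min_m n.
  by rewrite leqNgt lt_nm => h; have := h (asboolT nJ).
by move=> _; apply: contrapT => nJ; apply: noex; exists n; apply/asboolP.
Qed.

End IdealFacts.

Section InitialPreimage.
Variables (R : comNzRingType) (M : set R).
Implicit Types (J : set R) (K : set (gr M)) (p : blowup_ring M).

(** The existence of [p] also encodes that [a] lies in [M ^ n]. Since [val] is injective, [p] is
    determined by [a] and [n]. *)
Definition initial_preimage K n : set R :=
  [set a | exists2 p : blowup_ring M,
     val p = a%:P * 'X^n & K (quo_class (gr_rel_ideal M) p)].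

Lemma monomial_blowup n a :
  ideal_pow M n a -> exists p : blowup_ring M, val p = a%:P * 'X^n.
Proof.
move=> Ma; suff Hp : blowup_pred M (a%:P * 'X^n) by exists (Sub _ Hp).
apply/asboolP => i; rewrite coefCM coefXn; case: eqP => [->|_].
  by rewrite mulr1.
by rewrite mulr0; have [] := ideal_pow_ideal M i.
Qed.

Lemma initial_preimage_sub K n : initial_preimage K n `<=` ideal_pow M n.
Proof.
move=> a [[p /= /asboolP Mp] def_p _]; have := Mp n.
by rewrite def_p coefCM coefXn eqxx mulr1.
Qed.

(** This adjunction lets inclusions between ideals of [gr M] be checked on coefficients in [R]. *)
Lemma In_subP K n J : J `<=` ideal_pow M n ->
  In n J `<=` K <-> J `<=` initial_preimage K n.
Proof.
move=> sJM; split=> [sJK a Ja|sJK _ [p [a Ja def_p] ->]].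
  have [p def_p] := monomial_blowup (sJM _ Ja).
  by exists p => //; apply: sJK; exists p => //; exists a.
have [q def_q Kq] := sJK _ Ja.
by have -> : p = q by apply: val_inj; rewrite def_p def_q.
Qed.

(** Only one factor has to lie over [K]: the other one, [b W^n], is an element of the blowup ring,
    and [K] absorbs its class. *)
Lemma initial_preimageM K m n a b : is_ideal K ->
  initial_preimage K m a -> ideal_pow M n b -> initial_preimage K (m + n) (b * a).
Proof.
move=> [_ _ KM] [p def_p Kp] /monomial_blowup [q def_q].
exists (q * p); last by rewrite rmorphM; apply: KM.
by rewrite rmorphM /= def_p def_q polyCM addnC exprD mulrACA.
Qed.

Lemma initial_preimage_ideal K n : is_ideal K -> is_ideal (initial_preimage K n).
Proof.
move=> hK; have [K0 KD _] := hK; split=> [|a b [p def_p Kp] [q def_q Kq]|c a Ka].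
- by exists 0; rewrite rmorph0 // mul0r.
- exists (p + q); last by rewrite rmorphD; apply: KD.
  by rewrite rmorphD /= def_p def_q polyCD mulrDl.
(* A scalar [c] counts as a coefficient of degree 0, because [M ^ 0] is the whole ring. *)
- by rewrite -[n]addn0; apply: initial_preimageM.
Qed.

(** A positive exponent leaves one factor in [J] to carry membership in [K]; the cofactor in [J ^ m]
    enters only through [M ^ (N * m)]. *)
Lemma ideal_pow_initial K N J m : is_ideal K ->
  J `<=` initial_preimage K N ->
  ideal_pow J m.+1 `<=` initial_preimage K (N * m.+1).
Proof.
move=> hK sJK.
have powJ : forall m, ideal_pow J m `<=` ideal_pow M (N * m).
  elim=> [|i IHi]; first by rewrite muln0.
  apply: ideal_gen_sub => [|_ [a [b [Ja Jb ->]]]]; first exact: ideal_pow_ideal.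
  rewrite mulnS; apply: ideal_powD (IHi _ Jb).
  by apply: initial_preimage_sub; apply: sJK.
apply: ideal_gen_sub => [|_ [a [b [Ja Jb ->]]]].
  exact: initial_preimage_ideal.
by rewrite mulnS mulrC; apply: initial_preimageM => //; [apply: sJK|apply: powJ].
Qed.

Lemma initial_preimage_radical K n r a : is_ideal K -> ideal_pow M n a ->
  initial_preimage K (n * r) (a ^+ r) -> initial_preimage (radical K) n a.
Proof.
move=> hK /monomial_blowup [p def_p] [q def_q Kq]; exists p => //.
exists r; rewrite -rmorphXn.
suff -> : p ^+ r = q by [].
by apply: val_inj; rewrite rmorphXn /= def_p def_q exprMn -polyC_exp exprM.
Qed.

(** Degree 0 is exempt from the condition on [K], so that constants belong to the set, as they must
    in a subalgebra. *)
Definition positive_part_in K : set {poly R} :=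
  [set p | blowup_pred M p /\ forall n, (0 < n)%N -> initial_preimage K n p`_n].

Lemma positive_part_in_subalgebra K :
  is_ideal K -> is_subalgebra (positive_part_in K).
Proof.
move=> hK; split=> [c|p q [Bp Kp] [Bq Kq]|p q [Bp Kp] [Bq Kq]].
- split=> [|[//|i] _]; last first.
    by rewrite coefC; have [] := initial_preimage_ideal i.+1 hK.
  apply/asboolP => -[//|i]; rewrite coefC.
  by have [] := ideal_pow_ideal M i.+1.
- split=> [|i i_gt0]; first exact: rpredD.
  have [_ KD _] := initial_preimage_ideal i hK.
  by rewrite coefD; apply: KD; [apply: Kp|apply: Kq].
- split=> [|i i_gt0]; first exact: rpredM.
  rewrite coefM; apply: ideal_sum => [|[j] /= lt_ji _].
    exact: initial_preimage_ideal.
  move/asboolP: Bp => Bp; move/asboolP: Bq => Bq.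
  (* In a term [p_j * q_(i-j)], the factor lying over [K] is [q_i] when [j = 0], because [i > 0],
     and [p_j] otherwise, even if [i - j = 0]. *)
  have [->|j_gt0] := posnP j.
    have [_ _ KM] := initial_preimage_ideal i hK.
    by rewrite subn0; apply: KM; apply: Kq.
  rewrite -{1}(subnKC (ltnSE lt_ji)) mulrC.
  by apply: initial_preimageM => //; apply: Kp.
Qed.

Lemma monomial_positive_part K n a : (0 < n)%N -> is_ideal K ->
  initial_preimage K n a -> positive_part_in K (a%:P * 'X^n).
Proof.
move=> n_gt0 hK Ka; split=> [|i _].
  by have [[p Bp] /= <-] := monomial_blowup (initial_preimage_sub Ka).
rewrite coefCM coefXn; case: eqP => [->|_]; first by rewrite mulr1.
by rewrite mulr0; have [] := initial_preimage_ideal i hK.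
Qed.

End InitialPreimage.

Section MonomialSubalgebra.
Variables (R : comNzRingType) (s : nat) (f : 'I_s -> R) (n : 'I_s -> nat).

Lemma monomial_subalgebraX i r :
  monomial_subalgebra f n (((f i)%:P * 'X^(n i)) ^+ r).
Proof.
move=> S hS sS; have [SC _ SM] := hS; elim: r => [|r IHr].
  by rewrite expr0 -polyC1; apply: SC.
by rewrite exprS; apply: SM => //; apply: sS; exists i.
Qed.

Lemma monomial_subalgebra_coefX i r (J : nat -> set R) :
  monomial_subalgebra f n `<=` [set p | forall m, J m p`_m] ->
  J (n i * r)%N (f i ^+ r).
Proof.
move=> /(_ _ (monomial_subalgebraX i r) (n i * r)%N).
by rewrite exprMn -polyC_exp -exprM coefCM coefXn eqxx mulr1.
Qed.

End MonomialSubalgebra.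

Section ReesStalks.
Variables (X : ringed_space) (x : X).
Implicit Type I : ideal_sheaf X.

(** Sections of the sheafified power lie in an actual power of [I] near [x]; after shrinking to such
    a neighbourhood, taking germs turns products into products. *)
Lemma stalk_pow_sheaf I m :
  stalk_ideal (pow_sheaf I m) x `<=` ideal_pow (stalk_ideal I x) m.
Proof.
move=> _ [U [Ux [a [Ia ->]]]]; have [W [h [Wx]]] := Ia x Ux.
rewrite -(germ_res Ux Wx h); move: (res h a) => {Ia} b.
elim: m b => [//|m IHm] b Ib.
have [K0 KD KM] := ideal_pow_ideal (stalk_ideal I x) m.+1.
apply: (Ib [set c | ideal_pow (stalk_ideal I x) m.+1 (germ Wx c)]).
  split=> [|c d Hc Hd|c d Hd] /=; rewrite ?rmorph0 ?rmorphD ?rmorphM //.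
    exact: KD.
  exact: KM.
move=> _ [c [d [Ic Id ->]]] /=; rewrite rmorphM.
by apply: ideal_mulP; [exists W, Wx, c|apply: IHm].
Qed.

(** Identifies [I_N] inside the degree [N] component of [rees_attached G N], which is defined as a
    first power. *)
Lemma sub_stalk_pow_sheaf1 I :
  stalk_ideal I x `<=` stalk_ideal (pow_sheaf I 1) x.
Proof.
move=> _ [U [Ux [a [Ia ->]]]]; exists U, Ux, a; split=> // y Uy.
exists U, (fun _ => id); split=> //; rewrite res_id -[a]mulr1.
exact: ideal_mulP.
Qed.

Lemma stalk_zero_sheaf : stalk_ideal (zero_sheaf X) x `<=` [set 0].
Proof. by move=> _ [U [Ux [a [-> ->]]]] /=; rewrite rmorph0. Qed.

End ReesStalks.

Theorem lemma5p4 (k : fieldType) (V : scheme)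
    (iota : {rmorphism k -> sec (opensT V)}) (smoothV : smooth_over iota)
    (G : nat -> ideal_sheaf V) (reesG : rees_algebra G)
    (x : V) (Sing_x : Sing G x)
    (s : nat) (f : 'I_s -> stalk x) (n : 'I_s -> nat)
    (n_gt0 : forall i, (0 < n i)%N)
    (G_x : rees_stalk G x = monomial_subalgebra f n)
    (N : nat) (N_gt0 : (0 < N)%N) (n_dvd_N : forall i, (n i %| N)%N) :
  let GN := rees_attached G N in
  let InN := ideal_gen (In (M := max_ideal x) N (stalk_ideal (G N) x)) in
  initial_ideal GN x = InN /\
  (radical (initial_ideal GN x) = radical InN /\
   radical InN = radical (initial_ideal G x)).
Proof.
move=> GN InN.
(* This is where [x] being a singular point enters: it makes [In_subP] applicable to every [I_i]. *)
have GM i : (0 < i)%N -> stalk_ideal (G i) x `<=` ideal_pow (max_ideal x) i.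
  by move=> i_gt0; apply: ideal_order_ge; apply: Sing_x.
have hInN : is_ideal InN by apply: ideal_gen_ideal.
have JN_InN : stalk_ideal (G N) x `<=` initial_preimage InN N.
  by apply/In_subP; [apply: GM|apply: sub_ideal_gen].
have claim1 : initial_ideal GN x = InN.
  apply/seteqP; split; last first.
    apply: ideal_gen_mono => _ [p [a Ja def_p] ->]; exists N => //.
    exists p => //; exists a => //.
    rewrite /GN /rees_attached dvdnn divnn N_gt0.
    exact: sub_stalk_pow_sheaf1.
  apply: ideal_gen_sub => // u [i i_gt0]; move: u.
  suff GNi : stalk_ideal (GN i) x `<=` initial_preimage InN i.
    by apply/In_subP => // a /GNi; apply: initial_preimage_sub.
  (* Degrees not divisible by [N] contribute zero; in degree [m * N], the condition [i > 0] forces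
     [m > 0], as [ideal_pow_initial] requires. *)
  rewrite /GN /rees_attached; case: ifP => [/dvdnP [m def_i]|_]; last first.
    move=> a /stalk_zero_sheaf ->.
    by have [] := initial_preimage_ideal i hInN.
  move: i_gt0; rewrite {}def_i mulnK //; case: m => // m _ a /stalk_pow_sheaf.
  by rewrite mulnC; apply: ideal_pow_initial.
split=> //; split; first by rewrite claim1.
apply/seteqP; split.
  apply: radical_mono; apply: ideal_gen_mono => u Hu.
  by exists N.
have hrad := radical_ideal hInN.
(* The radical is idempotent, so it suffices to put the generators of the initial ideal of [G] in
   the radical of [InN]. *)
suff sub : initial_ideal G x `<=` radical InN.
  by move=> u /(radical_mono sub); apply: radical_idem.
apply: ideal_gen_sub => // u [i i_gt0]; move: u.
apply/In_subP; first exact: GM.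
move=> a Ja.
have Ga : rees_stalk G x (a%:P * 'X^i).
  move=> j; rewrite coefCM coefXn; case: eqP => [->|_]; first by rewrite mulr1.
  rewrite mulr0; exists (opensT V), I, 0; split; last by rewrite rmorph0.
  by have [] := isec_ideal (G j) (opensT V).
rewrite G_x in Ga.
(* Membership in the generated subalgebra is eliminated into [positive_part_in (radical InN)],
   leaving only the generators to test. *)
have [] := Ga _ (positive_part_in_subalgebra hrad).
  move=> _ [j ->]; apply: monomial_positive_part => //.
  have Gf r : stalk_ideal (G (n j * r)%N) x (f j ^+ r).
    have := @monomial_subalgebra_coefX _ s f n j r (fun m => stalk_ideal (G m) x).
    by rewrite -G_x; apply.
  (* This exponent brings [f_j W^(n_j)] to degree exactly [N], so that its coefficient falls in
     [I_N]; exponent 1 in [Gf] shows [f_j] itself lies in [I_(n_j)]. *)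
  apply: (initial_preimage_radical (r := N %/ n j)) => //.
    by apply: GM => //; have := Gf 1%N; rewrite muln1 expr1.
  by have := Gf (N %/ n j)%N; rewrite mulnC divnK //; apply: JN_InN.
move=> _ /(_ i i_gt0).
by rewrite coefCM coefXn eqxx mulr1.
Qed.
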